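(* Let $d\in\mathbb{N}$, let $c\ge2$ be an integer, let $\beta\in(0,d]$, let $\varphi\in\Phi$ and let $F$ be a $G_\delta$-subset of $\mathbb{R}^d$ such that $$\mathcal{H}^{h_{\beta,\varphi}}\left(\bigcap_{n=1}^\infty f_n(F)\right)>0$$ for every sequence $(f_n)_{n\in\mathbb{N}}$ in $D_c$. Then $F$ belongs to $\mathrm{G}^{h_{\beta,\varphi}}(\mathbb{R}^d)$.
   Context: $\mathbb{R}^d$ is endowed with the supremum norm; $|\cdot|$ applied to a set denotes its diameter. $\mathfrak{D}_d$ (gauge functions) is the set of all functions $h$ that vanish at zero, are continuous and nondecreasing on $[0,\varepsilon]$ and are such that $r\mapsto h(r)/r^d$ is positive and nonincreasing on $(0,\varepsilon]$, for some $\varepsilon>0$ (only behaviour near zero matters). For $g,h\in\mathfrak{D}_d$, $g\prec h$ means that $g/h$ monotonically tends to infinity at zero. The Hausdorff $h$-measure is $\mathcal{H}^h(F)=\lim_{\delta\downarrow0}\inf\sum_{p\ge1}h(|U_p|)$, the infimum being over all sequences $(U_p)_{p\in\mathbb{N}}$ of sets with $F\subseteq\bigcup_pU_p$ and $|U_p|<\delta$ for all $p$. $\Lambda_c$ is the collection of $c$-adic cubes $c^{-j}(k+[0,1)^d)$, $j\in\mathbb{Z}$ (the generation), $k\in\mathbb{Z}^d$. $D_c$ is the set of all dilations (maps $x\mapsto ax+b$ with $a>0$, $b\in\mathbb{R}^d$) that map some $c$-adic cube $\lambda$ with diameter less than $1$ onto a $c$-adic cube with generation greater than or equal to that of $\lambda$.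 For $h\in\mathfrak{D}_d$ let $\varepsilon_h$ be the supremum of all $\varepsilon\in(0,1]$ such that $h$ is continuous and nondecreasing on $[0,\varepsilon]$ and $h(r)/r^d$ is positive and nonincreasing on $(0,\varepsilon]$. For $F\subseteq\mathbb{R}^d$, $\mathcal{M}^h_\infty(F)=\inf\sum_{p\ge1}h(|\lambda_p|)$, the infimum being over all sequences $(\lambda_p)_{p\in\mathbb{N}}$ in $\Lambda_c\cup\{\emptyset\}$ with $F\subseteq\bigcup_p\lambda_p$ and $|\lambda_p|<\varepsilon_h$ for all $p$. For a nonempty open $V\subseteq\mathbb{R}^d$, $\mathrm{G}^h(V)$ is the collection of all $G_\delta$-subsets $F$ of $\mathbb{R}^d$ such that $\mathcal{M}^g_\infty(F\cap U)=\mathcal{M}^g_\infty(U)$ for every $g\in\mathfrak{D}_d$ with $g\prec h$ and every open $U\subseteq V$. (It is known that $\mathrm{G}^h(V)$ depends on neither $c$ nor the norm.) $\Phi$ is the set of all functions $\varphi$ that are continuous and nondecreasing on $[0,\rho]$ for some $\rho>0$, vanish at zero, are such that $r^{-\varphi(r)}$ monotonically tends to infinity as $r\to0$, and are such that for every $\varepsilon>0$ the function $r\mapsto r^{\varepsilon-\varphi(r)}$ tends to zero at zero and increases in $(0,\rho_\varepsilon]$ for some $\rho_\varepsilon>0$. For $\beta\in(0,d]$ and $\varphi\in\Phi$, $h_{\beta,\varphi}(r)=r^{\beta-\varphi(r)}$ (with value $0$ at $0$), which belongs to $\mathfrak{D}_d$. *)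

(* Defs.v *)
From HB Require Import structures.
From mathcomp Require Import all_boot all_order all_algebra.
From mathcomp Require Import all_classical all_reals all_analysis borel_hierarchy.

Set Implicit Arguments.
Unset Strict Implicit.
Unset Printing Implicit Defensive.
Import Order.TTheory GRing.Theory Num.Theory.
Import numFieldNormedType.Exports.
Local Open Scope classical_set_scope.
Local Open Scope ring_scope.

(** R^d is ['rV[R]_d]; its library norm is the supremum norm.  Functions of a
    nonnegative variable are total functions [R -> R] of which only the values
    on some [[0, e]] are ever constrained or used. *)

Definition monotone_to_pinfty (R : realType) (f : R -> R) : Prop :=
  f r @[r --> 0^'+] --> +oo /\
  exists2 e : R, 0 < e & {in `]0, e] &, {homo f : x y /~ x <= y}}.

Definition gauge_on (R : realType) (d : nat) (h : R -> R) (e : R) : Prop :=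
  [/\ {within `[0, e], continuous h},
      {in `[0, e] &, {homo h : x y / x <= y}},
      {in `]0, e], forall r, 0 < h r / r ^+ d} &
      {in `]0, e] &, {homo (fun r => h r / r ^+ d) : x y /~ x <= y}}].

Definition gauge (R : realType) (d : nat) (h : R -> R) : Prop :=
  h 0 = 0 /\ exists2 e : R, 0 < e & gauge_on d h e.

Definition gauge_eps (R : realType) (d : nat) (h : R -> R) : R :=
  sup [set e | 0 < e <= 1 /\ gauge_on d h e].

(** g ≺ h: near 0 it is [g] that dominates [h]. *)
Definition gauge_prec (R : realType) (g h : R -> R) : Prop :=
  monotone_to_pinfty (fun r => g r / h r).

(** 0 is adjoined so that the diameter of the empty set is 0 and not -oo. *)
Definition diam (R : realType) (d : nat) (A : set 'rV[R]_d) : \bar R :=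
  ereal_sup (0%E |` [set `|x.1 - x.2|%:E | x in A `*` A]).

Definition covers_below (R : realType) (d : nat) (F : set 'rV[R]_d) (e : R)
    (U : (set 'rV[R]_d)^nat) : Prop :=
  F `<=` \bigcup_p U p /\ forall p, (diam (U p) < e%:E)%E.

(** [fine] is harmless: only applied when all the [diam (U p)] are finite. *)
Definition cover_cost (R : realType) (d : nat) (h : R -> R)
    (U : (set 'rV[R]_d)^nat) : \bar R :=
  (\sum_(0 <= p <oo) (h (fine (diam (U p))))%:E)%E.

Definition hausdorff_pre (R : realType) (d : nat) (h : R -> R)
    (F : set 'rV[R]_d) (delta : R) : \bar R :=
  ereal_inf [set cover_cost h U | U in covers_below F delta].

(** For delta beyond the range where [h] is a gauge, [hausdorff_pre] may be
    junk; the limit does not see these values. *)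
Definition hausdorff_measure (R : realType) (d : nat) (h : R -> R)
    (F : set 'rV[R]_d) : \bar R :=
  lim (hausdorff_pre h F delta @[delta --> 0^'+]).

(** The cube c^-j (k + [0,1)^d), of generation j. *)
Definition cadic_cube (R : realType) (d c : nat) (j : int) (k : 'rV[int]_d) :
    set 'rV[R]_d :=
  [set c%:R ^ (- j) *: (map_mx intr k + u)
    | u in [set u : 'rV[R]_d | forall i, 0 <= u 0 i < 1]].
Arguments cadic_cube R {d} c j k.

Definition is_cadic_cube (R : realType) (d c : nat) (A : set 'rV[R]_d) : Prop :=
  exists (j : int) (k : 'rV[int]_d), A = cadic_cube R c j k.

Definition cadic_dilation (R : realType) (d c : nat)
    (f : 'rV[R]_d -> 'rV[R]_d) : Prop :=
  (exists (a : R) (b : 'rV[R]_d), 0 < a /\ f = (fun x => a *: x + b)) /\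
  (exists (j j' : int) (k k' : 'rV[int]_d),
    [/\ (diam (cadic_cube R c j k) < 1)%E, j <= j' &
        f @` cadic_cube R c j k = cadic_cube R c j' k']).

Definition net_measure (R : realType) (d c : nat) (h : R -> R)
    (F : set 'rV[R]_d) : \bar R :=
  ereal_inf [set cover_cost h U | U in
    [set U : (set 'rV[R]_d)^nat | covers_below F (gauge_eps d h) U /\
       forall p, is_cadic_cube c (U p) \/ U p = set0]].

Definition large_intersection (R : realType) (d c : nat) (h : R -> R)
    (V : set 'rV[R]_d) : set (set 'rV[R]_d) :=
  [set F | Gdelta F /\
    forall g : R -> R, gauge d g -> gauge_prec g h ->
    forall U : set 'rV[R]_d, open U -> U `<=` V ->
      net_measure c g (F `&` U) = net_measure c g U].

Definition Phi (R : realType) (phi : R -> R) : Prop :=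
  [/\ exists2 rho : R, 0 < rho &
        {within `[0, rho], continuous phi} /\
        {in `[0, rho] &, {homo phi : x y / x <= y}},
      phi 0 = 0,
      monotone_to_pinfty (fun r => r `^ (- phi r)) &
      forall e : R, 0 < e ->
        r `^ (e - phi r) @[r --> 0^'+] --> 0 /\
        exists2 rho_e : R, 0 < rho_e &
          {in `]0, rho_e] &, {homo (fun r => r `^ (e - phi r)) : x y / x < y}}].

Definition h_beta_phi (R : realType) (beta : R) (phi : R -> R) : R -> R :=
  fun r => if r == 0 then 0 else r `^ (beta - phi r).

(* Main.v *)
(** Write h for the gauge h_{beta,phi}, and suppose M^g(F ∩ U) < M^g(U).  Comparing
    a cheap cover of F ∩ U with the maximal small cubes of U yields a cube l of
    side s such that F ∩ l is covered by subcubes of sides r_p with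
    sum g(r_p) < g(s).  As g/h is monotone, sum h(r_p) < h(s).  Since phi is
    monotone and tends to 0, h(a r_p)/h(a s) is dominated by a constant times
    h(r_p), and for a -> 0 its upper limit is at most h(r_p)/h(s); so for some
    q < 1 and all small a we have sum h(a r_p) <= q h(a s).

    Let E be the intersection of the images of F under all dilations mapping l to
    cubes of generation at least that of l.  In each sufficiently small cube m the
    image of the cover of F ∩ l covers E ∩ m, with cost at most q h(|m|).  Hence
    the outer measure M built from h and small cubes satisfies
    M(E ∩ A) <= q M(E ∩ A), so that M(E) = 0 and H^h(E) = 0. *)

Require Import Defs.
From mathcomp Require Import all_boot all_order all_algebra.
From mathcomp Require Import all_classical all_reals all_analysis borel_hierarchy.
From mathcomp Require Import ring lra zify.
Import Order.TTheory GRing.Theory Num.Theory.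
Import numFieldNormedType.Exports.
Local Open Scope classical_set_scope.
Local Open Scope ring_scope.

(** * c-adic cubes *)

Lemma rV_norm_lt (R : realType) (d : nat) (x : 'rV[R]_d) (e : R) : 0 < e ->
  `|x| < e <-> forall i, `|x 0 i| < e.
Proof.
move=> e0; rewrite [`|x|]mx_normrE; split.
  by move=> /bigmax_ltP[_ H] i; exact: (H (0, i)).
by move=> H; apply/bigmax_ltP; split=> // -[i j] _ /=; rewrite ord1.
Qed.

Lemma rV_norm_ge (R : realType) (d : nat) (x : 'rV[R]_d) (i : 'I_d) :
  `|x 0 i| <= `|x|.
Proof.
by rewrite [leRHS]mx_normrE; apply/bigmax_geP; right; exists (0, i).
Qed.

Section cubes.
Variables (R : realType) (d c : nat).
Hypothesis hc : (2 <= c)%N.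
Local Notation C := (c%:R : R).
Implicit Types (j : int) (k : 'rV[int]_d) (x y : 'rV[R]_d).

Lemma base_gt0 : 0 < C. Proof. by rewrite ltr0n; lia. Qed.
Lemma base_gt1 : 1 < C. Proof. by rewrite ltr1n; lia. Qed.
Lemma base_exp_gt0 j : 0 < C ^ j. Proof. by rewrite exprz_gt0 // base_gt0. Qed.

Lemma base_expD i j : C ^ (i + j) = C ^ i * C ^ j.
Proof. by rewrite expfzDr // gt_eqF // base_gt0. Qed.

Lemma base_expVK j : C ^ (- j) * C ^ j = 1.
Proof. by rewrite -base_expD addNr expr0z. Qed.

Lemma le_base_exp i j : (C ^ i <= C ^ j) = (i <= j).
Proof. by rewrite ler_eXz2l // base_gt1. Qed.

Lemma in_cadic_cube j k x :
  cadic_cube R c j k x <->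
  forall i, (k 0 i)%:~R <= C ^ j * x 0 i < (k 0 i)%:~R + 1.
Proof.
split=> [[u hu <-] i|H].
  rewrite !mxE mulrA -base_expD subrr expr0z mul1r.
  have /andP[u0 u1] := hu i; lra.
exists (C ^ j *: x - map_mx intr k).
  by move=> i; rewrite !mxE; have /andP[u0 u1] := H i; lra.
by rewrite addrC subrK scalerA base_expVK scale1r.
Qed.

(** Indexing a cube by a point in it reduces the comparison of two cubes that meet to a comparison
    at a common point. *)
Definition cube_at j x := cadic_cube R c j (map_mx Num.floor (C ^ j *: x)).

Lemma mem_cube_at j x : cube_at j x x.
Proof.
apply/in_cadic_cube => i; rewrite !mxE floor_le /=.
by have := floorD1_gt (C ^ j * x 0 i); rewrite intrD.
Qed.

Lemma cube_atE {j k x} : cadic_cube R c j k x -> cadic_cube R c j k = cube_at j x.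
Proof.
move=> /in_cadic_cube H; congr cadic_cube; apply/matrixP => i i'.
by rewrite ord1 !mxE; apply/esym/floor_def; rewrite intrD; exact: H.
Qed.

(** For an integer [N = c ^ n], [N * floor X <= floor (N * X)] and
    [floor (N * X) + 1 <= N * (floor X + 1)], so a finer interval never crosses an end of a coarser
    one. *)
Lemma cube_at_nested i j x : i <= j -> cube_at j x `<=` cube_at i x.
Proof.
move=> ij y /in_cadic_cube H; apply/in_cadic_cube => l.
have [n jE] : exists n : nat, j = i + n%:Z.
  by exists `|j - i|%N; lia.
move: (H l); rewrite jE !mxE base_expD.
set X := C ^ i * x 0 l; set Y := C ^ i * y 0 l.
have -> : C ^ i * C ^ n%:Z * x 0 l = C ^+ n * X by rewrite /X exprnP; ring.
have -> : C ^ i * C ^ n%:Z * y 0 l = C ^+ n * Y by rewrite /Y exprnP; ring.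
have cn0 : 0 < C ^+ n by rewrite exprn_gt0 // base_gt0.
have cE : C ^+ n = ((c%:Z) ^+ n)%:~R :> R by rewrite rmorphXn.
have fl1 : c%:Z ^+ n * Num.floor X <= Num.floor (C ^+ n * X).
  by rewrite floor_ge_int intrM -cE ler_pM2l // floor_le.
have fl2 : Num.floor (C ^+ n * X) + 1 <= c%:Z ^+ n * (Num.floor X + 1).
  rewrite lezD1 floor_lt_int intrM -cE ltr_pM2l //; exact: floorD1_gt.
rewrite -(ler_int R) intrM -cE in fl1; rewrite -(ler_int R) intrM !intrD -cE in fl2.
move=> /andP[h3 h4]; apply/andP; split.
  by rewrite -(ler_pM2l cn0); lra.
by rewrite -(ltr_pM2l cn0); lra.
Qed.

Lemma cube_at_eq {j x y} : cube_at j x y -> cube_at j x = cube_at j y.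
Proof. exact: cube_atE. Qed.

Lemma dist_lt_cube j k x y : cadic_cube R c j k x -> cadic_cube R c j k y ->
  `|x - y| < C ^ (- j).
Proof.
move=> /in_cadic_cube hx /in_cadic_cube hy.
apply/rV_norm_lt => [|i]; first exact: base_exp_gt0.
rewrite -(ltr_pM2l (base_exp_gt0 j)) mulrC [X in _ < X]mulrC base_expVK.
rewrite -(gtr0_norm (base_exp_gt0 j)) mulrC -normrM !mxE.
have /andP[x1 x2] := hx i; have /andP[y1 y2] := hy i.
by rewrite mulrBr ltr_norml; apply/andP; split; lra.
Qed.

Lemma diam_ge0 (A : set 'rV[R]_d) : (0 <= diam A)%E.
Proof. by apply: ereal_sup_ubound; left. Qed.

Lemma diam_set0 : diam (@set0 'rV[R]_d) = 0%E.
Proof.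
rewrite /diam (_ : _ `|` _ = [set 0%E]) ?ereal_sup1 //.
by apply/seteqP; split=> y /=; [move=> [//|[x [[]]]]|left].
Qed.

Lemma diam_cube (d0 : (0 < d)%N) j k : diam (cadic_cube R c j k) = (C ^ (- j))%:E.
Proof.
apply/eqP; rewrite eq_le; apply/andP; split.
  apply: ge_ereal_sup => _ [->|[[x y] [/= hx hy] <-]].
    by rewrite lee_fin ltW // base_exp_gt0.
  by rewrite lee_fin ltW // (dist_lt_cube _ _ _ _ hx hy).
apply/lee_subgt0Pr => e e0.
(* The cube is half-open, so the diameter is only approached: [t <= 1/2] keeps [pt (1 - t)] in the
   cube, and [t <= C ^ j * e] makes the loss [C ^ (- j) * t] at most [e]. *)
pose t := Num.min (2^-1) (C ^ j * e).
have t0 : 0 < t by rewrite lt_min invr_gt0 ltr0n /= mulr_gt0 // base_exp_gt0.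
have t1 : t <= 2^-1 by rewrite ge_min lexx.
have te : t <= C ^ j * e by rewrite ge_min lexx orbT.
pose pt (s : R) := C ^ (- j) *: (map_mx intr k + \row_(i < d) s) : 'rV[R]_d.
apply: (@le_trans _ _ (`|pt (1 - t) - pt 0|%:E)); last first.
  apply: ereal_sup_ubound; right; exists (pt (1 - t), pt 0) => //=.
  split; rewrite /pt; eexists; try reflexivity; move=> i; rewrite !mxE; lra.
rewrite -EFinB lee_fin; apply: le_trans (rV_norm_ge _ _ _ (Ordinal d0)).
rewrite !mxE -mulrBr opprD addrACA subrr add0r subr0.
rewrite ger0_norm; last by rewrite mulr_ge0 ?(ltW (base_exp_gt0 _)) //; lra.
rewrite mulrBr mulr1 lerD2l lerN2 -(ler_pM2l (base_exp_gt0 j)) mulrA -base_expD.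
by rewrite subrr expr0z mul1r.
Qed.

Lemma cube_sub_gen (d0 : (0 < d)%N) {i j k l} :
  cadic_cube R c i k `<=` cadic_cube R c j l -> j <= i.
Proof.
move=> sub; rewrite -lerN2 -le_base_exp -lee_fin -(diam_cube d0 i k) -(diam_cube d0 j l).
apply: ereal_sup_le => _ [->|[[x y] [hx hy] <-]]; first by left.
by right; exists (x, y) => //; split; exact: sub.
Qed.

Lemma base_exp_small (e : R) : 0 < e -> exists n : nat, C ^ (- n%:Z) <= e.
Proof.
move=> e0; exists (Num.bound e^-1).
have e1 : 0 < e^-1 by rewrite invr_gt0.
rewrite -exprnN -[leRHS]invrK lef_pV2 ?posrE ?exprn_gt0 ?base_gt0 //.
apply/ltW/(lt_le_trans (archi_boundP (ltW e1))).
by rewrite -natrX ler_nat ltnW // ltn_expl.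
Qed.

Lemma cube_at_sub_open (U : set 'rV[R]_d) x (j : int) : open U -> U x ->
  exists n : nat, cube_at (j + n%:Z) x `<=` U.
Proof.
move=> oU Ux; have /nbhs_ballP[e /= e0 sub] := open_nbhs_nbhs (conj oU Ux).
have [n hn] := base_exp_small (e * C ^ j) (mulr_gt0 e0 (base_exp_gt0 j)).
exists n => y hy; apply: sub; rewrite -ball_normE /=.
apply: lt_le_trans (dist_lt_cube _ _ _ _ (mem_cube_at _ _) hy) _.
rewrite opprD base_expD -(ler_pM2r (base_exp_gt0 j)) mulrAC base_expVK mul1r.
exact: hn.
Qed.

Lemma cube_at_cases i j x : cube_at i x `<=` cube_at j x \/ cube_at j x `<=` cube_at i x.
Proof.
by have [ij|/ltW ij] := leP i j; [right|left]; exact: cube_at_nested.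
Qed.

(** The translation is chosen so that the cube of generation [j] and index 0 goes to the cube of
    generation [j + m] and index [k]. *)
Definition cube_dilation (j : int) (m : nat) (k : 'rV[int]_d) x : 'rV[R]_d :=
  C ^ (- m%:Z) *: x + C ^ (- (j + m%:Z)) *: map_mx intr k.

(** The index shift [c ^ n * k] is integral because [n >= 0]; thus the grids of all generations from
    [j] on are respected. *)
Lemma cube_dilation_image j m k (n : nat) l :
  cube_dilation j m k @` cadic_cube R c (j + n%:Z) l =
  cadic_cube R c (j + n%:Z + m%:Z) (l + c%:Z ^+ n *: k).
Proof.
rewrite /cadic_cube image_comp; apply: eq_imagel => u _ /=.
apply/matrixP => i i'; rewrite ord1 !mxE.
rewrite intrD intrM rmorphXn /= !opprD !base_expD exprnP.
have -> : (c%:Z%:~R : R) = C by [].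
have : C ^ (- n%:Z) * C ^ n%:Z = 1 := base_expVK n.
set X := C ^ (- n%:Z); set Y := C ^ n%:Z => XY.
transitivity (C ^ (- j) * X * C ^ (- m%:Z) * ((l 0 i')%:~R + u 0 i')
  + X * Y * (C ^ (- j) * C ^ (- m%:Z) * (k 0 i')%:~R)); last by ring.
by rewrite XY; ring.
Qed.

Lemma cube_dilationP (d0 : (0 < d)%N) j m k :
  C ^ (- j) < 1 -> cadic_dilation c (cube_dilation j m k).
Proof.
move=> j1; split.
  by exists (C ^ (- m%:Z)), (C ^ (- (j + m%:Z)) *: map_mx intr k);
    rewrite base_exp_gt0.
exists j, (j + m%:Z), 0, k; split; first by rewrite diam_cube // lte_fin.
  by rewrite lerDl.
by have := cube_dilation_image j m k 0 0; rewrite addr0 expr0 scale1r add0r.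
Qed.

Lemma cube_dilation_inj j m k : injective (cube_dilation j m k).
Proof.
move=> x y /addIr /(scalerI _); apply.
by rewrite gt_eqF // base_exp_gt0.
Qed.

End cubes.

(** * Reduction to a single cube *)

Lemma nneseries_single (R : realType) (x : \bar R) (n : nat) : (0 <= x)%E ->
  (\sum_(0 <= m <oo) (if n == m then x else 0) = x)%E.
Proof.
move=> x0; rewrite (@nneseriesD1 _ _ n) //; last by move=> k _; case: ifP.
by rewrite eqxx eseries0 ?adde0 // => i _ /=; rewrite eq_sym => /negbTE ->.
Qed.

(** The terms [a q] are grouped by the value of [rep q]; after the sums are interchanged, each is
    counted exactly once. *)
Lemma nneseries_regroup (R : realType) (a b : nat -> \bar R) (rep : nat -> nat) :
  (forall q, 0 <= a q)%E -> (forall m, 0 <= b m)%E ->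
  (forall m, b m <= \sum_(0 <= q <oo) (if rep q == m then a q else 0))%E ->
  (\sum_(0 <= m <oo) b m <= \sum_(0 <= q <oo) a q)%E.
Proof.
move=> a0 b0 ba.
apply: (@le_trans _ _ (\sum_(0 <= m <oo) \sum_(0 <= q <oo)
  (if rep q == m then a q else 0))%E).
  by apply: lee_nneseries => // m _; exact: ba.
rewrite nneseries_interchange; last by move=> i j; case: ifP.
apply: lee_nneseries => q _; last by rewrite nneseries_single.
by move=> _; apply: nneseries_ge0 => m _ _; case: ifP.
Qed.

Section local_to_global.
Variables (R : realType) (d c : nat).
Hypotheses (hc : (2 <= c)%N) (d0 : (0 < d)%N).
Local Notation C := (c%:R : R).
Variables (g : R -> R) (j1 : int) (F U : set 'rV[R]_d).
Hypothesis g0 : g 0 = 0.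
Hypothesis gpos : forall r, 0 < r < gauge_eps d g -> 0 < g r.
Hypothesis j1small : C ^ (- j1) < gauge_eps d g.
(** The failure of this condition provides the cube and the cheap cover from which a null
    intersection of dilates is built. *)
Hypothesis F_large : forall (n : nat) k (W : (set 'rV[R]_d)^nat),
  (forall p, (is_cadic_cube c (W p) \/ W p = set0) /\
     W p `<=` cadic_cube R c (j1 + n%:Z) k) ->
  F `&` cadic_cube R c (j1 + n%:Z) k `<=` \bigcup_p W p ->
  ((g (C ^ (- (j1 + n%:Z))))%:E <= cover_cost g W)%E.
Hypothesis oU : open U.

(** The largest cube around [x], of generation at least [j1], that fits in [U]. These cubes
    partition [U]. *)
Let maxcube (x : 'rV[R]_d) (M : set 'rV[R]_d) := exists n : nat,
  [/\ M = cube_at R d c (j1 + n%:Z) x, M `<=` U &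
      forall m, (m < n)%N -> ~ (cube_at R d c (j1 + m%:Z) x `<=` U)].

Let maxcube_ex x : U x -> exists M, maxcube x M.
Proof.
move=> Ux; have := cube_at_sub_open _ _ _ hc _ _ j1 oU Ux.
move=> [n0 hn0].
have ex : exists n : nat, `[< cube_at R d c (j1 + n%:Z) x `<=` U >].
  by exists n0; exact/asboolP.
exists (cube_at R d c (j1 + (ex_minn ex)%:Z) x).
exists (ex_minn ex); case: ex_minnP => n /asboolP hn hmin; split=> // m mn.
by move=> /asboolP /hmin; rewrite leqNgt mn.
Qed.

Let maxcube_self x M : maxcube x M -> M x.
Proof. by case=> n [-> _ _]; exact: mem_cube_at. Qed.

(** The coarser cubes around [z] are those around [x], so maximality does not depend on the chosen
    point of [M]. *)
Let maxcube_mem x z M : maxcube x M -> M z -> maxcube z M.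
Proof.
move=> [n [ME MU Mmin]] Mz; exists n.
have MzE : M = cube_at R d c (j1 + n%:Z) z.
  by rewrite ME; apply: cube_at_eq => //; rewrite -ME.
split=> // m mn sub; apply: (Mmin m mn).
rewrite -(@cube_at_eq R d c hc _ z x) //.
apply: (@cube_at_nested R d c hc _ (j1 + n%:Z)); first by lia.
by rewrite -MzE ME; exact: mem_cube_at.
Qed.

Let maxcube_uniq x y z M N : maxcube x M -> maxcube y N -> M z -> N z -> M = N.
Proof.
move=> xM yN Mz Nz.
have [n [-> MU Mmin]] := maxcube_mem _ _ _ xM Mz.
have [m [-> NU Nmin]] := maxcube_mem _ _ _ yN Nz.
by have [/Nmin|/Mmin|->] := ltngtP n m.
Qed.

Let gauge_eps_gt0 : 0 < gauge_eps d g.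
Proof. exact: lt_trans (base_exp_gt0 _ _ hc _) j1small. Qed.

Let cost_ge0 (A : set 'rV[R]_d) : (diam A < (gauge_eps d g)%:E)%E ->
  (0 <= (g (fine (diam A)))%:E)%E.
Proof.
have := diam_ge0 _ _ A; case: (diam A) => //= r; rewrite !lee_fin lte_fin => r0 re.
move: r0; rewrite le_eqVlt => /predU1P[<-|r0]; first by rewrite g0.
by rewrite ltW // gpos // r0.
Qed.

Section one_cover.
Variable L : (set 'rV[R]_d)^nat.
Hypothesis Lcover : covers_below (F `&` U) (gauge_eps d g) L.
Hypothesis Lcube : forall p, is_cadic_cube c (L p) \/ L p = set0.

Let chosen M := (exists x, maxcube x M) /\ forall p, ~ (M `<=` L p).

(** Cubes that meet are nested, and [chosen] excludes that [M] lies in [L q]. *)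
Let L_in_chosen M q z : chosen M -> L q z -> M z -> L q `<=` M.
Proof.
move=> [[x xM] Mn] Lz Mz.
have [n [ME _ _]] := maxcube_mem _ _ _ xM Mz.
case: (Lcube q) => [[j [k LE]]|LE]; last by rewrite LE.
have LzE : L q = cube_at R d c j z by rewrite LE; apply: cube_atE => //; rewrite -LE.
by have [|] := cube_at_cases R d c hc j (j1 + n%:Z) z; rewrite -ME -LzE // => /Mn.
Qed.

(* If [L q] lies in a maximal cube of [U] that no member of the cover contains,
   then [B q] is that cube; otherwise [B q = L q].  Each cube so obtained is kept
   only once, at the index selected by [rep]. *)
Let block q := [set M | [/\ chosen M, L q `<=` M & L q !=set0]].
Let B q := xget (L q) (block q).

Let B_chosen M q z : chosen M -> L q z -> M z -> B q = M.
Proof.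
move=> cM Lz Mz.
have bM : block q M by split=> //; [exact: L_in_chosen Lz Mz | exists z].
have [[[x xB] _] LB _] := xgetPex (L q) (ex_intro _ M bM).
have [[y yM] _] := cM.
exact: maxcube_uniq xB yM (LB _ Lz) Mz.
Qed.

Let B_cases q : B q = L q \/ block q (B q).
Proof. by rewrite /B; case: xgetP => [M -> ?|]; [right|left]. Qed.

Let L_sub_B q : L q `<=` B q.
Proof. by case: (B_cases q) => [->|[]]. Qed.

Let rep q := get [set p | B p = B q].

Let repE q : B (rep q) = B q.
Proof.
exact: (@getPex _ [set p | B p = B q] (ex_intro _ q erefl)).
Qed.

Let rep_eq p q : B p = B q -> rep p = rep q.
Proof. by rewrite /rep => ->. Qed.

Let V m := if rep m == m then B m else set0.

Let B_small q : (diam (B q) < (gauge_eps d g)%:E)%E.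
Proof.
case: (B_cases q) => [->|[[[x [n [-> _ _]]] _] _ _]]; first by case: Lcover.
rewrite diam_cube // lte_fin; apply: le_lt_trans j1small.
by rewrite le_base_exp // lerN2 lerDl.
Qed.

Let V_small q : (diam (V q) < (gauge_eps d g)%:E)%E.
Proof.
by rewrite /V; case: ifP => _; rewrite ?B_small // diam_set0 lte_fin.
Qed.

Let V_cube q : is_cadic_cube c (V q) \/ V q = set0.
Proof.
rewrite /V; case: ifP => _; last by right.
case: (B_cases q) => [->|[[[x [n [-> _ _]]] _] _ _]]; first exact: Lcube.
by left; exists (j1 + n%:Z); eexists.
Qed.

Let B_sub_V q : B q `<=` \bigcup_m V m.
Proof.
move=> x Bx; exists (rep q) => //; rewrite /V (rep_eq (rep q) q) ?repE //.
by rewrite eqxx.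
Qed.

Let V_cover : U `<=` \bigcup_m V m.
Proof.
move=> x Ux; have [M xM] := maxcube_ex _ Ux.
have [cM|] := pselect (chosen M); last first.
  move=> /not_andP[|/existsNP[p /contrapT MLp]]; first by case; exists x.
  apply: (B_sub_V p); apply: L_sub_B; apply: MLp; exact: maxcube_self.
have [n [ME MU _]] := xM.
(* A chosen cube meets [F]: otherwise the empty cover, of cost 0, would contradict [F_large]. *)
have [y [Fy My]] : exists y, F y /\ M y.
  apply: contrapT => /forallNP no.
  have := @F_large n (map_mx Num.floor (C ^ (j1 + n%:Z) *: x)) (fun=> set0).
  rewrite /cover_cost diam_set0 /= eseries0 ?g0 // lee_fin leNgt gpos /=.
    move=> H; suff: false by []; apply: H.
    - by move=> p; split; [right|].
    - by move=> y [Fy]; rewrite -/(cube_at R d c _ x) -ME => My; case: (no y).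
  rewrite base_exp_gt0 //=; apply: le_lt_trans j1small.
  by rewrite le_base_exp // lerN2 lerDl.
have [q _ Lqy] := Lcover.1 y (conj Fy (MU _ My)).
by apply: (B_sub_V q); rewrite (B_chosen _ _ _ cM Lqy My); exact: maxcube_self.
Qed.

(** A kept member of [L] is paid for by its own term; a kept maximal cube costs, by [F_large], no
    more than the members of [L] that it absorbs. *)
Let V_cost : (cover_cost g V <= cover_cost g L)%E.
Proof.
have a0 q : (0 <= (g (fine (diam (L q))))%:E)%E by apply: cost_ge0; case: Lcover.
apply: (@nneseries_regroup _ _ _ rep) => // m; first exact: cost_ge0.
have aif q : (0 <= if rep q == m then (g (fine (diam (L q))))%:E else 0)%E.
  by case: ifP.
rewrite {1}/V; case: ifP => [/eqP repm|_]; last first.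
  by rewrite diam_set0 /= g0; apply: nneseries_ge0 => q _ _; exact: aif.
case: (B_cases m) => [->|[cB _ _]].
  rewrite (@nneseriesD1 _ _ m) // repm eqxx leeDl // nneseries_ge0 //.
have [[x [n [BE BU _]]] _] := cB.
have -> : fine (diam (B m)) = C ^ (- (j1 + n%:Z)) by rewrite BE diam_cube.
(* The members of [L] absorbed by [B m]; they lie in [B m] and cover its part of [F]. *)
pose W q := if rep q == m then L q else set0.
have WL q : W q `<=` B m.
  rewrite /W; case: ifP => [/eqP rqm z Lz|_ //].
  by rewrite -rqm repE; exact: L_sub_B.
apply: le_trans (F_large n (map_mx Num.floor (C ^ (j1 + n%:Z) *: x)) W _ _) _.
- move=> p; split; first by rewrite /W; case: ifP => _; [exact: Lcube|right].
  by rewrite -/(cube_at R d c _ x) -BE.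
- rewrite -/(cube_at R d c _ x) -BE => z [Fz Bz].
  have [q _ Lqz] := Lcover.1 z (conj Fz (BU _ Bz)).
  exists q => //; rewrite /W.
  by rewrite (rep_eq q m (B_chosen _ _ _ cB Lqz Bz)) repm eqxx.
rewrite /cover_cost; apply: lee_nneseries => q _.
  by move=> _; apply: cost_ge0; rewrite /W; case: ifP => _; [case: Lcover|rewrite diam_set0].
by rewrite /W; case: ifP => // _; rewrite diam_set0 /= g0.
Qed.

Lemma net_measure_le_cover : (net_measure c g U <= cover_cost g L)%E.
Proof.
apply: le_trans V_cost; apply: ereal_inf_lbound.
exists V; last by [].
by split; [split; [exact: V_cover | exact: V_small] | exact: V_cube].
Qed.

End one_cover.

Lemma net_measure_local : net_measure c g (F `&` U) = net_measure c g U.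
Proof.
apply/eqP; rewrite eq_le; apply/andP; split.
  apply: ereal_inf_le_tmp => _ [L [[LU Ls] Lc] <-]; exists L => //; split=> //.
  by split=> // x [_ /LU].
apply: le_ereal_inf_tmp => _ [L [Lcov Lc] <-].
exact: net_measure_le_cover.
Qed.

End local_to_global.

(** * Scaling of the gauge *)

Lemma common_threshold (R : realType) (P : nat -> R -> Prop) :
  (forall p, exists2 e : R, 0 < e & forall a : R, 0 < a <= e -> P p a) ->
  forall N, exists2 e : R, 0 < e & forall a : R, 0 < a <= e ->
    forall p, (p < N)%N -> P p a.
Proof.
move=> H; elim=> [|N [e e0 he]]; first by exists 1.
have [e' e'0 he'] := H N; exists (Num.min e e'); first by rewrite lt_min e0.
move=> a; rewrite le_min => /and3P[a0 ae ae'] p.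
rewrite ltnS leq_eqVlt => /predU1P[->|pN]; first by apply: he'; rewrite a0.
by apply: he => //; rewrite a0.
Qed.

Section h_scaling.
Variables (R : realType) (beta : R) (phi : R -> R) (rho : R).
Hypothesis rho1 : rho <= 1.
Hypothesis phi_homo : forall x y : R, 0 <= x -> x <= y -> y <= rho -> phi x <= phi y.
Hypothesis phi0 : phi 0 = 0.
Hypothesis phi_cvg : phi x @[x --> 0^'+] --> 0.
Hypothesis powphi_homo : forall x y : R, 0 < x -> x <= y -> y <= rho ->
  y `^ (- phi y) <= x `^ (- phi x).
Local Notation h := (h_beta_phi beta phi).

Lemma h_beta_phi0 : h 0 = 0.
Proof. by rewrite /h_beta_phi eqxx. Qed.

Lemma h_beta_phiE (r : R) : 0 < r -> h r = r `^ (beta - phi r).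
Proof. by move=> r0; rewrite /h_beta_phi gt_eqF. Qed.

Lemma h_beta_phi_ge0 (r : R) : 0 <= h r.
Proof. by rewrite /h_beta_phi; case: ifP => // _; exact: powR_ge0. Qed.

Lemma h_beta_phi_gt0 (r : R) : 0 < r -> 0 < h r.
Proof. by move=> r0; rewrite h_beta_phiE // powR_gt0. Qed.

Let phi_ge0 (x : R) : 0 <= x -> x <= rho -> 0 <= phi x.
Proof. by move=> x0 xr; rewrite -phi0 phi_homo. Qed.

(** Here [a * r = a * r' * (r / r')], and lowering the exponent from [beta - phi (a * r)] to
    [beta - phi (a * r')] increases a power of base at most 1. *)
Lemma h_scale_powR (a r r' : R) : 0 < a <= 1 -> 0 < r -> r <= r' -> r' <= rho ->
  h (a * r) <= h (a * r') * (r / r') `^ (beta - phi (a * r')).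
Proof.
move=> /andP[a0 a1] r0 rr rrho.
have r'0 : 0 < r' by exact: lt_le_trans rr.
have ar : 0 < a * r by rewrite mulr_gt0.
have ar' : 0 < a * r' by rewrite mulr_gt0.
have le1 : a * r <= a * r' by rewrite ler_pM2l.
have le2 : a * r' <= r' by rewrite ger_pMl.
have t0 : 0 <= r / r' by rewrite divr_ge0 // ltW.
rewrite !h_beta_phiE // -powRM ?(ltW ar') //.
rewrite (_ : a * r' * (r / r') = a * r); last by field; rewrite gt_eqF.
apply: ger_powR; first by rewrite ar (le_trans le1) // (le_trans le2) // (le_trans rrho).
by rewrite lerD2l lerN2 phi_homo //; lra.
Qed.

(** The last factor is independent of [a], which gives the domination for the tail of the series.
    Powers of [a] and of [r] are treated separately, through [phi (a * r) <= phi (a * r')] and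
    [phi (a * r) <= phi r]. *)
Lemma h_scale_dom (a r r' : R) : 0 < a <= 1 -> 0 < r -> r <= r' -> r' <= rho ->
  h (a * r) <= h (a * r') * (h r / r' `^ beta).
Proof.
move=> /andP[a0 a1] r0 rr rrho.
have r'0 : 0 < r' by exact: lt_le_trans rr.
have ar : 0 < a * r by rewrite mulr_gt0.
have ar' : 0 < a * r' by rewrite mulr_gt0.
have le1 : a * r <= a * r' by rewrite ler_pM2l.
have le2 : a * r' <= r' by rewrite ger_pMl.
have le3 : a * r <= r by rewrite ger_pMl.
rewrite !h_beta_phiE // !powRM ?(ltW a0) ?(ltW r0) ?(ltW r'0) //.
rewrite -mulrA; apply: ler_pM; rewrite ?powR_ge0 //.
  apply: ger_powR; first by rewrite a0.
  by rewrite lerD2l lerN2 phi_homo //; lra.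
rewrite mulrCA; apply: (@le_trans _ _ (r `^ (beta - phi r))).
  apply: ger_powR; first by rewrite r0 (le_trans rr) // (le_trans rrho).
  by rewrite lerD2l lerN2 phi_homo //; lra.
(* What remains is [r' ^ beta <= r' ^ (beta - phi (a * r'))], from [r' <= 1] and [phi >= 0]. *)
rewrite ler_peMr ?powR_ge0 // ler_pdivlMr ?powR_gt0 // mul1r.
apply: ger_powR; first by rewrite r'0 (le_trans rrho).
by rewrite lerBlDr lerDl phi_ge0 //; lra.
Qed.

(** The quotient [h r / h r'] is [(r / r') ^ beta] times the ratio of [r ^ (- phi r)] to
    [r' ^ (- phi r')], which is at least 1. *)
Lemma powR_le_h_ratio (r r' : R) : 0 < r -> r <= r' -> r' <= rho ->
  (r / r') `^ beta <= h r / h r'.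
Proof.
move=> r0 rr rrho; have r'0 : 0 < r' by exact: lt_le_trans rr.
rewrite ler_pdivlMr ?h_beta_phi_gt0 // !h_beta_phiE //.
have t0 : 0 <= r / r' by rewrite divr_ge0 // ltW.
rewrite [r `^ _]powRD ?(gt_eqF r0) ?implybT // [r' `^ (_ - _)]powRD ?(gt_eqF r'0) ?implybT //.
rewrite mulrA -powRM ?(ltW r'0) // (_ : r / r' * r' = r); last first.
  by field; rewrite gt_eqF.
by rewrite ler_pM2l ?powR_gt0 // powphi_homo.
Qed.

Lemma powR_phi_le (t e r' : R) : 0 < t <= 1 -> 0 < e -> 0 < r' ->
  exists2 a0 : R, 0 < a0 & forall a : R, 0 < a <= a0 -> t `^ (- phi (a * r')) <= 1 + e.
Proof.
move=> /andP[t0 t1] e0 r'0.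
have lnt : 0 <= - ln t by rewrite oppr_ge0 ln_le0.
have lne : 0 < ln (1 + e) by rewrite ln_gt0 // ltrDl.
(* If [phi (a * r') <= x0], then [- phi (a * r') * ln t <= ln (1 + e)]; the 1 in the denominator
   keeps it positive when [t = 1]. *)
pose x0 := ln (1 + e) / (1 - ln t).
have x00 : 0 < x0 by rewrite divr_gt0 //; lra.
have [/= b b0 hb] := (cvgrPdist_le _ _).1 phi_cvg _ x00.
exists (b / (2 * r')); first by rewrite divr_gt0 // mulr_gt0.
move=> a /andP[a0 ab].
have ar0 : 0 < a * r' by rewrite mulr_gt0.
have : `|phi (a * r')| <= x0.
  rewrite -normrN -sub0r; apply: hb => //=.
  rewrite sub0r normrN gtr0_norm //.
  move: ab; rewrite ler_pdivlMr ?mulr_gt0 //; lra.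
move=> /ler_normlP[_ px].
rewrite /powR gt_eqF // -ler_ln ?posrE ?expR_gt0 //; last by lra.
rewrite expRK mulNr -mulrN; apply: (@le_trans _ _ (x0 * (- ln t))).
  by rewrite ler_wpM2r.
rewrite /x0 mulrAC ler_pdivrMr; last by lra.
by rewrite ler_pM2l //; lra.
Qed.

(** The power of [r / r'] left by [h_scale_powR] splits into [(r / r') ^ beta], at most
    [h r / h r'], and a correction that tends to 1 as [a] tends to 0. *)
Lemma h_scale_lim (r r' e : R) : 0 <= r -> r <= r' -> 0 < r' -> r' <= rho -> 0 < e ->
  exists2 a0 : R, 0 < a0 & forall a : R, 0 < a <= a0 ->
    h (a * r) <= (1 + e) * (h (a * r') / h r') * h r.
Proof.
rewrite le_eqVlt => /predU1P[<-|r0] rr r'0 rrho e0.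
  by exists 1 => // a _; rewrite mulr0 h_beta_phi0 mulr0.
have t01 : 0 < r / r' <= 1.
  by rewrite divr_gt0 //= ler_pdivrMr // mul1r.
have [b b0 hb] := powR_phi_le _ _ r' t01 e0 r'0.
exists (Num.min b 1); first by rewrite lt_min b0 /=.
move=> a; rewrite le_min => /and3P[a0 ab a1].
apply: le_trans (h_scale_powR _ _ r' _ r0 rr rrho) _; first by rewrite a0.
rewrite powRD; last by case/andP: t01 => t0 _; rewrite (gt_eqF t0) implybT.
rewrite (_ : (1 + e) * _ * _ = h (a * r') * (h r / h r' * (1 + e))); last by ring.
apply: ler_wpM2l; first exact: h_beta_phi_ge0.
apply: ler_pM; rewrite ?powR_ge0 //; first exact: powR_le_h_ratio.
by apply: hb; rewrite a0.
Qed.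

(* Dominated convergence: the ratios [h (a * r p) / h (a * r')] tend to
   [(r p / r')^beta <= h (r p) / h r'] as a -> 0 and are bounded by a constant
   times [h (r p)], which is summable. *)
Lemma h_scale_contraction (r : nat -> R) (r' : R) :
  (forall p, 0 <= r p <= r') -> 0 < r' -> r' <= rho ->
  (\sum_(0 <= p <oo) (h (r p))%:E < (h r')%:E)%E ->
  exists2 q : R, 0 < q < 1 & exists2 a0 : R, 0 < a0 & forall a : R, 0 < a <= a0 ->
    (\sum_(0 <= p <oo) (h (a * r p))%:E <= (q * h (a * r'))%:E)%E.
Proof.
move=> hr r'0 rrho Slt.
have h0 p : (0 <= (h (r p))%:E)%E by rewrite lee_fin h_beta_phi_ge0.
have S0 : (0 <= \sum_(0 <= p <oo) (h (r p))%:E)%E by apply: nneseries_ge0.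
have [s sE] : exists s, (\sum_(0 <= p <oo) (h (r p))%:E = s%:E)%E.
  exists (fine (\sum_(0 <= p <oo) (h (r p))%:E)%E); rewrite fineK //.
  by rewrite ge0_fin_numE // (lt_trans Slt) // ltry.
rewrite sE lee_fin in S0; rewrite sE lte_fin in Slt.
have hr'0 := h_beta_phi_gt0 _ r'0.
pose sg := s / h r'.
have sg1 : sg < 1 by rewrite ltr_pdivrMr // mul1r.
have sg0 : 0 <= sg by rewrite divr_ge0 // ltW.
have pb0 : 0 < r' `^ beta by rewrite powR_gt0.
(* In units of [h (a * r')], the first [N] terms will cost at most [(1 + (1 - sg) / 2) * sg] and the
   tail [(1 - sg) / 4], together at most [1 - (1 - sg) / 4]. The factor [r' ^ beta] cancels the
   denominator from [h_scale_dom]. *)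
pose eta := r' `^ beta * ((1 - sg) / 4).
have eta0 : 0 < eta by rewrite mulr_gt0 // divr_gt0 //; lra.
have [N tailN] : exists N, (\sum_(N <= p <oo) (h (r p))%:E <= eta%:E)%E.
  have fin : (\sum_(0 <= p <oo) (h (r p))%:E < +oo)%E by rewrite sE ltry.
  have nbhs_eta : nbhs 0%E [set y : \bar R | (y < eta%:E)%E].
    by apply: open_nbhs_nbhs; split; [exact: open_ereal_lt_ereal|rewrite /= lte_fin].
  have [N _ hN] := nneseries_tail_cvg fin (fun p _ => h0 p) nbhs_eta.
  by exists N; apply/ltW/hN => /=.
exists (1 - (1 - sg) / 4); first by lra.
have e0 : 0 < (1 - sg) / 2 by lra.
have [b b0 hb] := common_threshold _ _ (fun p => h_scale_lim (r p) r' _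
  (proj1 (andP (hr p))) (proj2 (andP (hr p))) r'0 rrho e0) N.
exists (Num.min b 1); first by rewrite lt_min b0 /=.
move=> a; rewrite le_min => /and3P[a0 ab a1].
have ha0 p : (0 <= (h (a * r p))%:E)%E by rewrite lee_fin h_beta_phi_ge0.
have har0 : 0 <= h (a * r') by exact: h_beta_phi_ge0.
rewrite (nneseries_split 0 N) // add0n.
pose k1 := (1 + (1 - sg) / 2) * (h (a * r') / h r').
pose k2 := h (a * r') / r' `^ beta.
have k10 : 0 <= k1 by rewrite mulr_ge0 ?divr_ge0 // ?(ltW hr'0) //; lra.
have k20 : 0 <= k2 by rewrite divr_ge0 // ltW.
apply: (@le_trans _ _ (k1%:E * s%:E + k2%:E * eta%:E)%E).
  apply: leeD.
    rewrite -sE; apply: (@le_trans _ _ (k1%:E * \sum_(0 <= p < N) (h (r p))%:E)%E).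
      rewrite ge0_sume_distrr; last by move=> p _; exact: h0.
      rewrite !big_mkord; apply: lee_sum => p _; rewrite -EFinM lee_fin.
      by apply: hb; rewrite ?a0 //.
    apply: lee_wpmul2l; first by rewrite lee_fin.
    exact: nneseries_lim_ge.
  apply: (@le_trans _ _ (k2%:E * \sum_(N <= p <oo) (h (r p))%:E)%E).
    rewrite -nneseriesZl //; apply: lee_nneseries => // p _.
    rewrite -EFinM lee_fin; have /andP[] := hr p.
    rewrite le_eqVlt => /predU1P[<-|rp0] rpr.
      by rewrite mulr0 h_beta_phi0 mulr0.
    apply: le_trans (h_scale_dom _ _ r' _ rp0 rpr rrho) _; first by rewrite a0.
    by rewrite /k2 mulrA mulrAC.
  by apply: lee_wpmul2l; rewrite ?lee_fin.
rewrite -!EFinM -EFinD lee_fin.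
have -> : k1 * s = (1 + (1 - sg) / 2) * sg * h (a * r').
  by rewrite /k1 /sg; field; rewrite gt_eqF.
have -> : k2 * eta = (1 - sg) / 4 * h (a * r').
  by rewrite /k2 /eta; field; rewrite gt_eqF.
rewrite -mulrDl; apply: ler_wpM2r => //.
nra.
Qed.

End h_scaling.

(** * Positivity of gauges, and a contraction principle for outer measures *)

Lemma gauge_eps_spec (R : realType) (d : nat) (g : R -> R) : gauge d g ->
  0 < gauge_eps d g /\ forall r, 0 < r < gauge_eps d g -> 0 < g r.
Proof.
move=> [_ [e e0 [gc gm gp gd]]].
set S := [set e | 0 < e <= 1 /\ gauge_on d g e].
have ubS : has_ubound S by exists 1 => x [/andP[]].
have le_in (r : R) x : r <= e -> x \in `]0, r] -> x \in `]0, e].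
  by move=> re; rewrite !in_itv /= => /andP[-> /le_trans]; apply.
have le_in' (r : R) x : r <= e -> x \in `[0, r] -> x \in `[0, e].
  by move=> re; rewrite !in_itv /= => /andP[-> /le_trans]; apply.
pose e1 := Num.min e 1.
have e1e : e1 <= e by rewrite ge_min lexx.
have e11 : e1 <= 1 by rewrite ge_min lexx orbT.
have e10 : 0 < e1 by rewrite lt_min e0 /=.
have Se1 : S e1.
  split; first by rewrite e10.
  split.
  - apply: continuous_subspaceW gc => x /=.
    exact: le_in'.
  - by move=> x y hx hy; apply: gm; apply: le_in' e1e _.
  - by move=> x hx; apply: gp; apply: le_in e1e _.
  - by move=> x y hx hy; apply: gd; apply: le_in e1e _.
have supS : has_sup S by split; [exists e1|].
split; first by apply: lt_le_trans e10 _; apply: ub_le_sup.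
move=> r /andP[r0 rS]; have [x [/andP[x0 _] [_ _ xp _]] rx] := sup_gt (ex_intro _ e1 Se1) rS.
have := xp r; rewrite in_itv /= r0 (ltW rx) => /(_ isT).
by rewrite pmulr_lgt0 // invr_gt0 exprn_gt0.
Qed.

Lemma mu_ext_contraction (dsp : measure_display) (T : semiRingOfSetsType dsp)
    (R : realType) (mu : set T -> \bar R) (E : set T) (q : R) :
  (forall B, 0 <= mu B)%E -> 0 < q < 1 ->
  (forall B, measurable B -> mu_ext mu (E `&` B) <= q%:E * mu B)%E ->
  forall A, (mu_ext mu (E `&` A) < +oo)%E -> mu_ext mu (E `&` A) = 0%E.
Proof.
move=> mu0 /andP[q0 q1] muE A Afin.
have M0 := mu_ext_ge0 mu0 (E `&` A).
have [m mE] : exists m, mu_ext mu (E `&` A) = m%:E.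
  by exists (fine (mu_ext mu (E `&` A))); rewrite fineK // ge0_fin_numE.
(* Applying the bound to each member of a cover gives [m <= q * (sum of the weights)]; passing to
   the infimum yields [m <= q * m] with [m] finite, hence [m = 0]. *)
have le_cover B : measurable_cover (E `&` A) B ->
    ((q^-1 * m)%:E <= \sum_(0 <= i <oo) mu (B i))%E.
  move=> [mB AB].
  have : (m%:E <= q%:E * \sum_(0 <= i <oo) mu (B i))%E.
    rewrite -mE; apply: (@le_trans _ _ (mu_ext mu (\bigcup_i (E `&` B i)))).
      apply: le_mu_ext => x [Ex Ax]; have [i _ Bx] := AB x (conj Ex Ax).
      by exists i.
    apply: le_trans (mu_ext_sigma_subadditive mu0 _) _.
    rewrite -nneseriesZl //; apply: lee_nneseries => i _.
      by move=> _; exact: mu_ext_ge0.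
    exact: muE.
  by rewrite EFinM -lee_pdivrMl.
have : ((q^-1 * m)%:E <= m%:E)%E.
  by rewrite -[leRHS]mE; apply: le_ereal_inf_tmp => _ [B cB <-]; exact: le_cover.
rewrite mE lee_fin ler_pdivrMl // => le1; rewrite mE lee_fin in M0.
congr EFin; nra.
Qed.

(** * The net outer measure of the intersection of dilates *)

Section net_outer_measure.
Variables (R : realType) (d c : nat).
Hypotheses (hc : (2 <= c)%N) (d0 : (0 < d)%N).
Local Notation C := (c%:R : R).
Variables (h : R -> R) (j1 : int).
Hypothesis h0 : h 0 = 0.
Hypothesis h_ge0 : forall r, 0 <= h r.
Hypothesis h_gt0 : forall r : R, 0 < r -> 0 < h r.
Hypothesis h_homo : forall x y : R, 0 < x -> x <= y -> y <= C ^ (- j1) -> h x <= h y.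

Definition small_cube (A : set 'rV[R]_d) :=
  A = set0 \/ exists (n : nat) k, A = cadic_cube R c (j1 + n%:Z) k.

(* Infinite weight off the small cubes, on the discrete sigma-algebra, makes
   [mu_ext] the outer measure of Method I for covers by small cubes. *)
Definition cube_weight (A : set (g_sigma_algebraType [set: set 'rV[R]_d])) : \bar R :=
  if `[< small_cube A >] then (h (fine (diam (A : set 'rV[R]_d))))%:E else +oo%E.

Local Notation M := (mu_ext cube_weight).

Lemma measurable_discrete (A : set (g_sigma_algebraType [set: set 'rV[R]_d])) :
  measurable A.
Proof. exact: sub_sigma_algebra. Qed.

Lemma cube_weight_ge0 A : (0 <= cube_weight A)%E.
Proof. by rewrite /cube_weight; case: ifP => _; rewrite ?leey // lee_fin. Qed.

Lemma cube_weightE A : small_cube A -> cube_weight A = (h (fine (diam A)))%:E.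
Proof. by move=> sA; rewrite /cube_weight asboolT. Qed.

Lemma cube_weight0 : cube_weight set0 = 0%E.
Proof. by rewrite cube_weightE ?diam_set0 /= ?h0 //; left. Qed.

Lemma net_outer_le (A : set 'rV[R]_d) (V : (set 'rV[R]_d)^nat) :
  A `<=` \bigcup_p V p -> (M A <= \sum_(0 <= p <oo) cube_weight (V p))%E.
Proof.
move=> AV; apply: ereal_inf_lbound; exists V => //; split=> // i.
exact: measurable_discrete.
Qed.

(** Covering by the cube alone supplies the finiteness that the contraction principle requires. *)
Lemma net_outer_cube_fin (E : set 'rV[R]_d) n k :
  (M (E `&` cadic_cube R c (j1 + n%:Z) k) < +oo)%E.
Proof.
set Q := cadic_cube R c (j1 + n%:Z) k.
have sQ : small_cube Q by right; exists n, k.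
pose V (p : nat) := if 0%N == p then Q else set0.
have EV : E `&` Q `<=` \bigcup_p V p by move=> x [_ Qx]; exists 0%N.
apply: le_lt_trans (net_outer_le _ _ EV) _.
rewrite (@eq_eseriesr _ _ (fun p => if 0%N == p then cube_weight Q else 0%E)); last first.
  by move=> p _; rewrite /V; case: ifP => // _; rewrite cube_weight0.
rewrite nneseries_single; last exact: cube_weight_ge0.
by rewrite cube_weightE // ltry.
Qed.

Lemma net_outer_null (E : set 'rV[R]_d) :
  (forall n k, M (E `&` cadic_cube R c (j1 + n%:Z) k) = 0%E) -> M E = 0%E.
Proof.
(* [Q] enumerates the cubes of generation [j1]; codes that decode to nothing repeat the cube of
   index 0. *)
move=> ME; pose Q n := cadic_cube R c (j1 + 0%:Z) (odflt 0 (unpickle n)) : set 'rV[R]_d.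
apply/eqP; rewrite eq_le; apply/andP; split; last first.
  by apply: mu_ext_ge0; exact: cube_weight_ge0.
apply: (@le_trans _ _ (M (\bigcup_n (E `&` Q n)))).
  apply: le_mu_ext => x Ex.
  exists (pickle (map_mx Num.floor (C ^ (j1 + 0%:Z) *: x))) => //; split=> //.
  by rewrite /Q pickleK /=; exact: mem_cube_at.
apply: le_trans (mu_ext_sigma_subadditive cube_weight_ge0 _) _.
by rewrite eseries0 // => n _ _; exact: ME.
Qed.

(** By monotonicity of [h], a cover of cost below [h t] has only members of diameter below [t]: a
    small cost alone makes the cover fine enough for the Hausdorff premeasure. *)
Lemma net_outer_hausdorff (E : set 'rV[R]_d) : M E = 0%E ->
  hausdorff_measure h E = 0%E.
Proof.
move=> ME.
have pre0 (delta : R) : 0 < delta -> hausdorff_pre h E delta = 0%E.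
  move=> delta0; apply/eqP; rewrite eq_le; apply/andP; split; last first.
    apply: le_ereal_inf_tmp => _ [V _ <-]; apply: nneseries_ge0 => p _ _.
    by rewrite lee_fin.
  apply/lee_addgt0Pr => e e0; rewrite add0e.
  pose t := Num.min (delta / 2) (C ^ (- j1)).
  have t0 : 0 < t by rewrite lt_min divr_gt0 //= base_exp_gt0.
  have td : t < delta.
    by apply: (@le_lt_trans _ _ (delta / 2)); [rewrite ge_min lexx | lra].
  have tj : t <= C ^ (- j1) by rewrite ge_min lexx orbT.
  pose b := Num.min e (h t).
  have b0 : 0 < b by rewrite lt_min e0 h_gt0.
  have : (M E < b%:E)%E by rewrite ME lte_fin.
  move=> /ereal_inf_lt[_ [V [_ EV] <-] Vb].
  have Vp p : (cube_weight (V p) < (h t)%:E)%E.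
    apply: (@lt_le_trans _ _ b%:E); last by rewrite lee_fin ge_min lexx orbT.
    apply: le_lt_trans Vb; rewrite (@nneseriesD1 _ _ p) //; last first.
      by move=> k _; exact: cube_weight_ge0.
    by rewrite leeDl // nneseries_ge0 // => k _ _; exact: cube_weight_ge0.
  have sV p : small_cube (V p).
    by have := Vp p; rewrite /cube_weight; case: asboolP.
  apply: (@le_trans _ _ (cover_cost h V)); last first.
    rewrite /cover_cost; under eq_eseriesr do rewrite -cube_weightE //.
    by apply: le_trans (ltW Vb) _; rewrite lee_fin ge_min lexx.
  apply: ereal_inf_lbound; exists V => //; split=> // p.
  have := Vp p; rewrite cube_weightE //.
  case: (sV p) => [->|[n [k ->]]]; first by rewrite diam_set0 lte_fin.
  rewrite diam_cube //= !lte_fin => ht.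
  apply: lt_trans td; rewrite ltNge; apply/negP => tle.
  move: ht; rewrite ltNge h_homo // le_base_exp //.
  by rewrite lerN2 lerDl.
rewrite /hausdorff_measure; apply: lim_near_cst; first exact: ereal_hausdorff.
near=> delta; apply: pre0.
by near: delta; exact: nbhs_right_gt.
Unshelve. all: by end_near. Qed.

End net_outer_measure.

(** * Transporting a cheap cover by dilations *)

Section dilation_intersection.
Variables (R : realType) (d c : nat).
Hypotheses (hc : (2 <= c)%N) (d0 : (0 < d)%N).
Local Notation C := (c%:R : R).
Variables (beta : R) (phi : R -> R) (rho : R).
Hypothesis rho1 : rho < 1.
Hypothesis phi_homo : forall x y : R, 0 <= x -> x <= y -> y <= rho -> phi x <= phi y.
Hypothesis phi0 : phi 0 = 0.
Hypothesis phi_cvg : phi x @[x --> 0^'+] --> 0.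
Hypothesis powphi_homo : forall x y : R, 0 < x -> x <= y -> y <= rho ->
  y `^ (- phi y) <= x `^ (- phi x).
Local Notation h := (h_beta_phi beta phi).
Hypothesis h_homo : forall x y : R, 0 < x -> x <= y -> y <= rho -> h x <= h y.
Variables (F : set 'rV[R]_d) (j0 : int) (k0 : 'rV[int]_d).
Hypothesis j0rho : C ^ (- j0) <= rho.
Variable W : (set 'rV[R]_d)^nat.
Hypothesis Wcube : forall p, is_cadic_cube c (W p) \/ W p = set0.
Hypothesis Wsub : forall p, W p `<=` cadic_cube R c j0 k0.
Hypothesis FW : F `&` cadic_cube R c j0 k0 `<=` \bigcup_p W p.
Hypothesis Wcost : (cover_cost h W < (h (C ^ (- j0)))%:E)%E.

(** A sequence running through all [cube_dilation j0 m k]; codes that decode to nothing give the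
    identity. *)
Let dil n : 'rV[R]_d -> 'rV[R]_d :=
  if unpickle n is Some (m, k) then cube_dilation R d c j0 m k
  else cube_dilation R d c j0 0 0.

Let E := \bigcap_n (dil n @` F).

Let E_dil m k : E `<=` cube_dilation R d c j0 m k @` F.
Proof. by move=> x /(_ (pickle (m, k)) I); rewrite /dil pickleK. Qed.

Let W_gen p : W p = set0 \/ exists (n : nat) k, W p = cadic_cube R c (j0 + n%:Z) k.
Proof.
case: (Wcube p) => [[j [k WE]]|]; last by left.
right; have := Wsub p; rewrite WE => /(cube_sub_gen _ _ _ hc d0) j0j.
by exists `|j - j0|%N, k; congr cadic_cube; lia.
Qed.

Let diamW_le p : 0 <= fine (diam (W p)) <= C ^ (- j0).
Proof.
case: (W_gen p) => [->|[n [k ->]]].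
  by rewrite diam_set0 /= lexx ltW // base_exp_gt0.
rewrite diam_cube //= ltW ?base_exp_gt0 //= le_base_exp //.
by rewrite lerN2 lerDl.
Qed.

Lemma dilation_intersection_null : exists f : nat -> 'rV[R]_d -> 'rV[R]_d,
  (forall n, cadic_dilation c (f n)) /\
  hausdorff_measure h (\bigcap_n (f n @` F)) = 0%E.
Proof.
exists dil; rewrite -/E; split=> [n|].
  have j0lt : C ^ (- j0) < 1 by apply: le_lt_trans rho1.
  by rewrite /dil; case: (unpickle n) => [[m k]|]; exact: cube_dilationP.
have R0 := base_exp_gt0 R c hc (- j0).
have [q q01 [a0 a00 ha]] := h_scale_contraction R beta phi rho (ltW rho1)
  phi_homo phi0 phi_cvg powphi_homo (fun p => fine (diam (W p))) _ diamW_le R0 j0rho Wcost.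
(* Cubes of generation at least [j0 + m0] are images of the initial cube under ratios at most [a0],
   so [ha] applies to them. *)
have [m0 hm0] := base_exp_small R c hc a0 a00.
pose j1 : int := j0 + m0%:Z.
have j1rho : C ^ (- j1) <= rho.
  by apply: le_trans j0rho; rewrite le_base_exp // lerN2 lerDl.
have h00 := h_beta_phi0 R beta phi.
have hge0 := h_beta_phi_ge0 R beta phi.
pose mu := cube_weight R d c h j1.
have mu_ge0 : forall B, (0 <= mu B)%E := cube_weight_ge0 R d c h j1 hge0.
apply: (net_outer_hausdorff R d c hc d0 h j1) => //.
- exact: h_beta_phi_gt0.
- by move=> x y x0 xy yj; apply: h_homo => //; exact: le_trans j1rho.
apply: net_outer_null => // n k.
apply: (mu_ext_contraction _ _ _ mu E q) => //; last exact: net_outer_cube_fin.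
move=> B _; have [/andP[q0 q1]] := q01.
(* Off the small cubes the weight is infinite and the bound is trivial. *)
have [sB|nsB] := pselect (small_cube R d c j1 B); last first.
  by rewrite [mu B]/cube_weight asboolF // gt0_muley ?lte_fin // leey.
case: sB => [->|[{}n [{}k BE]]].
  rewrite setI0 [mu set0]cube_weight0 // mule0.
  by rewrite mu_ext0 // [LHS]cube_weight0.
have {BE}BE : B = cadic_cube R c (j0 + (m0 + n)%N%:Z) k.
  by rewrite BE /j1 PoszD addrA.
set m := (m0 + n)%N in BE.
(* The index [k - k0] makes [f] carry the initial cube onto [B]. *)
pose f := cube_dilation R d c j0 m (k - k0).
have fB : f @` cadic_cube R c j0 k0 = B.
  have := cube_dilation_image R d c hc j0 m (k - k0) 0 k0.
  by rewrite expr0 scale1r addr0 (addrC k0) subrK BE.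
pose a := C ^ (- m%:Z).
have aa0 : 0 < a <= a0.
  rewrite base_exp_gt0 //=; apply: le_trans hm0.
  by rewrite le_base_exp // lerN2 lez_nat leq_addr.
have sB : small_cube R d c j1 B.
  by right; exists n, k; rewrite BE /j1 /m PoszD addrA.
have sfW p : small_cube R d c j1 (f @` W p) /\
    fine (diam (f @` W p)) = a * fine (diam (W p)).
  case: (W_gen p) => [->|[l [k' ->]]].
    by rewrite image_set0 diam_set0 mulr0; split; [left|].
  rewrite cube_dilation_image // !diam_cube //; split; last first.
    by rewrite /= opprD base_expD // mulrC.
  right; eexists (n + l)%N, _.
  rewrite (_ : j0 + l%:Z + m%:Z = j1 + (n + l)%N%:Z) //.
  by rewrite /j1 /m !PoszD; ring.
apply: (@le_trans _ _ (\sum_(0 <= p <oo) mu (f @` W p))%E).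
  (* [E] lies in the image of [F] under [f]; as [f] is injective, a point of [E] in [B] comes from a
     point of [F] in the initial cube, hence from some [W p]. *)
  apply: net_outer_le => x [Ex]; rewrite -fB => -[y Qy fyx].
  have [z Fz fzx] := E_dil m (k - k0) x Ex.
  have zy : z = y by apply: (cube_dilation_inj R d c hc j0 m (k - k0)); rewrite fzx.
  have [p _ Wpy] := FW y (conj (eq_ind _ F Fz _ zy) Qy).
  by exists p => //; exists y.
rewrite [mu B]cube_weightE //.
have -> : fine (diam B) = a * C ^ (- j0).
  by rewrite BE diam_cube //= opprD base_expD // mulrC.
rewrite -EFinM; apply: le_trans (ha a aa0).
apply: lee_nneseries => p _; first by move=> _; exact: mu_ge0.
by have [sW dW] := sfW p; rewrite [mu _]cube_weightE // dW.
Qed.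

End dilation_intersection.

(** * Change of gauge and conclusion *)

Lemma le_cost_ratio (R : realType) (d : nat) (g h : R -> R) (r' : R)
    (W : (set 'rV[R]_d)^nat) :
  g 0 = 0 -> h 0 = 0 -> 0 < r' ->
  (forall r : R, 0 < r <= r' -> 0 < g r /\ 0 < h r) ->
  (forall r : R, 0 < r <= r' -> g r' / h r' <= g r / h r) ->
  (forall p, 0 <= fine (diam (W p)) <= r') ->
  (cover_cost g W < (g r')%:E)%E -> (cover_cost h W < (h r')%:E)%E.
Proof.
move=> g0 h0 r'0 gh_gt0 gh_mono Wr' Wcost.
have rr' : 0 < r' <= r' by rewrite r'0 lexx.
have [gr' hr'] := gh_gt0 r' rr'.
have q0 : 0 < h r' / g r' by rewrite divr_gt0.
have ge0 p : 0 <= g (fine (diam (W p))) /\ 0 <= h (fine (diam (W p))).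
  have /andP[] := Wr' p; rewrite le_eqVlt => /predU1P[<-|p0] pr.
    by rewrite g0 h0.
  by have [/ltW ? /ltW ?] := gh_gt0 _ (introT andP (conj p0 pr)).
(* As [g / h] is smallest at [r'], each term satisfies [h r <= (h r' / g r') * g r]. *)
apply: (@le_lt_trans _ _ ((h r' / g r')%:E * cover_cost g W)%E); last first.
  rewrite (_ : (h r')%:E = (h r' / g r')%:E * (g r')%:E)%E ?lte_pmul2l //.
  by rewrite -EFinM divfK // gt_eqF.
rewrite /cover_cost -nneseriesZl; last by move=> p _; rewrite lee_fin; case: (ge0 p).
apply: lee_nneseries => p _; first by rewrite lee_fin; case: (ge0 p).
have /andP[] := Wr' p; rewrite -EFinM lee_fin le_eqVlt => /predU1P[<-|p0] pr.
  by rewrite g0 h0 mulr0.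
have [gp hp] := gh_gt0 _ (introT andP (conj p0 pr)).
have := gh_mono _ (introT andP (conj p0 pr)).
rewrite ler_pdivrMr // mulrAC ler_pdivlMr // mulrAC => le1.
by rewrite ler_pdivlMr // [leLHS]mulrC [leRHS]mulrC.
Qed.

Theorem proposition1 (R : realType) (d c : nat) (hc : (2 <= c)%N)
  (beta : R) (hbeta : 0 < beta <= d%:R)
  (phi : R -> R) (hphi : Phi phi)
  (F : set 'rV[R]_d) (hF : Gdelta F)
  (hpos : forall f : nat -> 'rV[R]_d -> 'rV[R]_d,
     (forall n, cadic_dilation c (f n)) ->
     (0 < hausdorff_measure (h_beta_phi beta phi) (\bigcap_n (f n @` F)))%E) :
  large_intersection c (h_beta_phi beta phi) [set: 'rV[R]_d] F.
Proof.
have /andP[beta0 betad] := hbeta.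
have d0 : (0 < d)%N by rewrite -(ltr_nat R); exact: lt_le_trans betad.
have [[r1 r10 [phic phim]] phi0 [_ [r2 r20 powm]] powe] := hphi.
have [_ [r3 r30 hm]] := powe _ beta0.
split=> // g gg [_ [r4 r40 ghm]] U oU _.
have [eps0 gpos] := gauge_eps_spec _ _ _ gg.
have [g0 _] := gg.
set h := h_beta_phi beta phi in ghm *.
(* A common radius for all monotonicity conditions; [2^-1] and the halved threshold give the two
   strict inequalities. *)
pose rho := \big[Num.min/2^-1]_(r <- [:: r1; r2; r3; r4; gauge_eps d g / 2]) r.
have [rho0 [rho1 [rr1 [rr2 [rr3 [rr4 rreps]]]]]] : 0 < rho /\ rho < 1 /\ rho <= r1 /\
    rho <= r2 /\ rho <= r3 /\ rho <= r4 /\ rho < gauge_eps d g.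
  rewrite /rho !big_cons big_nil !lt_min !gt_min !ge_min !lexx !orbT.
  by do !split => //; lra.
have inI (x : R) : 0 < x -> x <= rho -> forall r, rho <= r -> x \in `]0, r].
  by move=> x0 xr r rr; rewrite in_itv /= x0 (le_trans xr).
have inC (x : R) : 0 <= x -> x <= rho -> x \in `[0, r1].
  by move=> x0 xr; rewrite in_itv /= x0 (le_trans xr).
have phi_homo (x y : R) : 0 <= x -> x <= y -> y <= rho -> phi x <= phi y.
  move=> x0 xy yr; have y0 := le_trans x0 xy; have xr := le_trans xy yr.
  by apply: phim => //; apply: inC.
have phi_cvg : phi x @[x --> 0^'+] --> 0.
  by have /(continuous_within_itvP _ r10)[_ + _] := phic; rewrite phi0.
have powphi_homo (x y : R) : 0 < x -> x <= y -> y <= rho ->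
    y `^ (- phi y) <= x `^ (- phi x).
  move=> x0 xy yr; have y0 := lt_le_trans x0 xy; have xr := le_trans xy yr.
  by apply: powm => //; apply: inI.
have h_homo (x y : R) : 0 < x -> x <= y -> y <= rho -> h x <= h y.
  move=> x0 xy yr; have y0 := lt_le_trans x0 xy; have xr := le_trans xy yr.
  rewrite /h !h_beta_phiE //; move: xy; rewrite le_eqVlt => /predU1P[->//|xy].
  by apply/ltW/hm => //; apply: inI.
have [n1 n1rho] := base_exp_small R c hc rho rho0.
apply: (net_measure_local R d c hc d0 g n1%:Z) => //.
  exact: le_lt_trans n1rho rreps.
(* A cover too cheap for [g] is assumed; it will be too cheap for [h] as well, and so produce
   dilations whose images of [F] have a null intersection, against [hpos]. *)
move=> n k W Wc FW; rewrite leNgt; apply/negP => Wcost.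
set j0 : int := n1%:Z + n%:Z in Wc FW Wcost.
have j0rho : c%:R ^ (- j0) <= rho.
  by apply: le_trans n1rho; rewrite le_base_exp // lerN2 lerDl.
have R0 := base_exp_gt0 R c hc (- j0).
have Wdiam p : 0 <= fine (diam (W p)) <= c%:R ^ (- j0).
  have [[[j [l WE]]|->] Wsub] := Wc p; last by rewrite diam_set0 /= lexx ltW.
  rewrite WE in Wsub *; rewrite diam_cube //= ltW ?base_exp_gt0 //=.
  by rewrite le_base_exp // lerN2; exact: cube_sub_gen _ _ _ hc d0 _ _ _ _ Wsub.
have hWcost : (cover_cost h W < (h (c%:R ^ (- j0)))%:E)%E.
  apply: (le_cost_ratio _ _ g) => //.
  - exact: h_beta_phi0.
  - move=> r /andP[r0 rr]; split; last exact: h_beta_phi_gt0.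
    by apply: gpos; rewrite r0; apply: le_lt_trans rreps; exact: le_trans j0rho.
  - move=> r /andP[r0 rr]; apply: (ghm (c%:R ^ (- j0)) r) => //; apply: inI => //.
    exact: le_trans j0rho.
have [f [fc f0]] := dilation_intersection_null R d c hc d0 beta phi rho rho1
  phi_homo phi0 phi_cvg powphi_homo h_homo F j0 k j0rho W (fun p => (Wc p).1)
  (fun p => (Wc p).2) FW hWcost.
by have := hpos f fc; rewrite f0 ltxx.
Qed.
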